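(* Let $\mathscr C$ be a countable collection of measurable sets in $(\mathcal X,\mathcal A)$, and suppose that for some $\alpha>0$, $\alpha\neq1$, and some constant $L>0$, $\log\mathcal N_I(\epsilon,\mathscr C,P)\le L\epsilon^{-\alpha}$ for all $\epsilon>0$. Let $a\in(0,1/2)$ be a known constant and, for a measurable set $C$, $f_C:=2\mathbf 1_C-1$. For $C_0\in\mathscr C$ let $Y_i=f_{C_0}(X_i)\eta_i$, $i=1,\dots,n$, where $X_1,\dots,X_n$ are i.i.d. with law $P$, and $\eta_1,\dots,\eta_n$ are i.i.d., independent of the $X_i$'s, with $\mathbb P(\eta_i=1)=1/2+a$ and $\mathbb P(\eta_i=-1)=1/2-a$. Let $\widehat C_n\in\arg\min_{C\in\mathscr C}\sum_{i=1}^n(Y_i-2af_C(X_i))^2$. Then $$\sup_{C_0\in\mathscr C}\mathbb E_{C_0}P|\widehat C_n\Delta C_0|\lesssim n^{-1/(\alpha+1)},$$ where the implied constant does not depend on $n$ (it depends only on $\alpha$, $L$ and $a$).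
   Context: $\mathcal N_I(\epsilon,\mathscr C,P)$ is the $\epsilon$-bracketing number of $\{\mathbf 1_C:C\in\mathscr C\}$ in $L_1(P)$: the minimum number of brackets $[\ell,u]=\{f:\ell\le f\le u\}$ with $\|u-\ell\|_{L_1(P)}<\epsilon$ needed to cover the class; $\log$ is the ordinary natural logarithm here. $P|\widehat C_n\Delta C_0|=\int(\mathbf 1_{\widehat C_n}-\mathbf 1_{C_0})^2\,dP$. $\mathbb E_{C_0}$ is expectation under the model with true set $C_0$. The least squares estimator $\widehat C_n$ is assumed to be well-defined. *)

(* Defs.v *)
From HB Require Import structures.
From mathcomp Require Import all_boot all_order all_algebra.
From mathcomp Require Import all_classical all_reals all_analysis.

Set Implicit Arguments.
Unset Strict Implicit.
Unset Printing Implicit Defensive.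

Import Order.TTheory GRing.Theory Num.Theory.
Import numFieldNormedType.Exports.

Local Open Scope classical_set_scope.
Local Open Scope ring_scope.

Definition bracket (T : Type) (R : realType) (l u : T -> R) : set (T -> R) :=
  [set f | forall x, l x <= f x <= u x].

Definition bracket_cover d (T : measurableType d) (R : realType)
    (P : probability T R) (eps : R) (F : set (T -> R)) (k : nat) : Prop :=
  exists l u : 'I_k -> T -> R,
    (forall j, [/\ P.-integrable setT (EFin \o l j),
                   P.-integrable setT (EFin \o u j)
                 & ('N[P]_1[EFin \o (u j \- l j)%R] < eps%:E)%E]) /\
    F `<=` \bigcup_j bracket (l j) (u j).

(* Extended-valued: +oo when no finite family of eps-brackets covers F. *)
Definition bracketing_number d (T : measurableType d) (R : realType)
    (P : probability T R) (eps : R) (F : set (T -> R)) : \bar R :=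
  ereal_inf [set k%:R%:E | k in bracket_cover P eps F].

Definition indicators (T : Type) (R : realType) (CC : set (set T)) :
    set (T -> R) :=
  [set (\1_C : T -> R) | C in CC].
Arguments indicators {T} R CC.

Definition sigma_rv d d' (Omega : measurableType d) (T : measurableType d')
    (X : Omega -> T) : set (set Omega) :=
  preimage_set_system setT X measurable.

Definition sigma_rvs d d' (Omega : measurableType d) (T : measurableType d')
    (n : nat) (X : 'I_n -> Omega -> T) : set (set Omega) :=
  <<s \bigcup_i sigma_rv (X i) >>.

Definition mutually_independent d d' (Omega : measurableType d)
    (T : measurableType d') (R : realType) (Pr : probability Omega R)
    (n : nat) (X : 'I_n -> Omega -> T) : Prop :=
  forall (J : {set 'I_n}) (E : 'I_n -> set Omega),
    (forall i, i \in J -> sigma_rv (X i) (E i)) ->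
    Pr (\bigcap_(i in [set` J]) E i) = (\prod_(i in J) Pr (E i))%E.

Definition independent_sigma d (Omega : measurableType d) (R : realType)
    (Pr : probability Omega R) (F G : set (set Omega)) : Prop :=
  forall A B, F A -> G B -> Pr (A `&` B) = (Pr A * Pr B)%E.

Definition argmin (I : Type) (R : realType) (D : set I) (g : I -> R) : set I :=
  [set c | D c /\ forall c', D c' -> g c <= g c'].

Definition fsgn (T : Type) (R : realType) (C : set T) (x : T) : R :=
  2 * \1_C x - 1.

Definition sq_loss (T : Type) (R : realType) (a : R) (n : nat)
    (x : 'I_n -> T) (y : 'I_n -> R) (C : set T) : R :=
  \sum_(i < n) (y i - 2 * a * fsgn R C (x i)) ^+ 2.

Definition symdiff_risk d (T : measurableType d) (R : realType)
    (P : probability T R) (C C0 : set T) : R :=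
  \int[P]_x ((\1_C x - \1_C0 x) ^+ 2).

(* Main.v *)
Require Import Defs.
From HB Require Import structures.
From mathcomp Require Import all_boot all_order all_algebra.
From mathcomp Require Import all_classical all_reals all_analysis.
From mathcomp Require Import measurable_realfun ring lra.

(* Since f_C0 f_C = 1 - 2 \1_D with D = C `+` C0, the least squares criterion
   says that sum_i eta_i \1_D(X_i) <= 0 for C = Chat. A single bracketing scale
   delta = n^(-1/(alpha+1)) suffices, because there the entropy
   L delta^(-alpha) = L n delta has the order of n delta. A bracket A <= C <= B
   gives Lo <= D <= U with P(U) <= P(Lo) + delta, and eta_i \1_D(X_i) is at
   least G_i := \1_Lo(X_i) or -\1_U(X_i) according to the sign of eta_i. As
   eta has mean 2a > 0,
     E exp(-(a/2) G_i) <= exp(a delta - (a^2/2) P(U)).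
   For the bracket of Chat, sum_i G_i <= 0, so z <= exp(z) with
   z = n ((a^2/2) P(U) - a delta) - log N, followed by a sum over the N brackets
   and by expectations, gives
     (a^2/2) n E P(D) <= log N + a n delta + 1,
   with neither tail bounds nor chaining, hence without the case distinction
   alpha < 1 or alpha > 1. *)

Set Implicit Arguments.
Unset Strict Implicit.
Unset Printing Implicit Defensive.

Import Order.TTheory GRing.Theory Num.Theory.
Import numFieldNormedType.Exports.

Local Open Scope classical_set_scope.
Local Open Scope ring_scope.

(** * An exponential inequality *)

(** From [exp(-x) >= 1 - x] one gets [exp x <= 1/(1-x)], and
    [(1 + x + 2x^2)(1 - x) - 1 = x^2 (1 - 2x)] is nonnegative in this range. *)
Lemma expR_le_quadratic (R : realType) (x : R) :
  x <= 1 / 2 -> expR x <= 1 + x + 2 * x ^+ 2.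
Proof.
move=> x_le.
have x1 : 0 < 1 - x by lra.
have h : expR x <= (1 - x)^-1.
  rewrite -[expR x]invrK -expRN lef_pV2 ?posrE ?expR_gt0 //.
  exact: expR_ge1Dx.
apply: (le_trans h); rewrite -[_^-1]mul1r ler_pdivrMr //.
have : 0 <= x ^+ 2 * (1 - 2 * x) by apply: mulr_ge0; [exact: sqr_ge0|lra].
nra.
Qed.

(** * Set brackets from bracketing numbers *)

(** An indicator above [l] equals 1 where [l > 0], and one below [u] vanishes where [u < 1], so
    thresholding turns function brackets into set brackets. *)
Lemma bracket_cover_sets d (T : measurableType d) (R : realType)
    (P : probability T R) (eps : R) (CC : set (set T)) (k : nat) :
  bracket_cover P eps (indicators R CC) k ->
  exists A B : 'I_k -> set T,
    (forall j, [/\ measurable (A j), measurable (B j)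
                 & (P (B j `\` A j) <= eps%:E)%E]) /\
    (forall C, CC C -> exists j, A j `<=` C /\ C `<=` B j).
Proof.
move=> [l [u [lu cov]]].
(* [u - l >= 1] wherever [l <= 0] and [u >= 1]. *)
exists (fun j => [set x | 0 < l j x]), (fun j => [set x | 1 <= u j x]); split.
  move=> j; have [il iu nlu] := lu j.
  have mA : measurable [set x | 0 < l j x].
    rewrite -[X in measurable X]setTI.
    exact: (emeasurable_fun_o_infty measurableT (measurable_int _ il) 0%:E).
  have mB : measurable [set x | 1 <= u j x].
    rewrite -[X in measurable X]setTI.
    exact: (emeasurable_fun_c_infty measurableT (measurable_int _ iu) 1%:E).
  split=> //.
  apply: le_trans (ltW nlu); rewrite Lnorm1.
  rewrite -[X in P X]setIT -integral_indic //; last exact: measurableD.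
  apply: ge0_le_integral => //.
  - by apply/measurable_EFinP; apply: measurable_indic; exact: measurableD.
  - apply: measurableT_comp => //.
    exact: emeasurable_funB (measurable_int _ iu) (measurable_int _ il).
  - move=> x _; rewrite lee_fin indicE.
    case: (boolP (x \in _)) => [|_]; last by rewrite normr_ge0.
    rewrite inE => -[/= ux /negP].
    rewrite -leNgt => lx; apply: le_trans (ler_norm _); lra.
move=> C CCC; have [//|j _ /= brj] := cov (\1_C); first by exists C.
exists j; split=> x /=.
  move=> lx; have /andP[lC _] := brj x; apply: contrapT => nC.
  by move: lC; rewrite indicE memNset// leNgt lx.
by move=> Cx; have /andP[_] := brj x; rewrite indicE mem_set.
Qed.

Lemma bracketing_number_lne d (T : measurableType d) (R : realType)
    (P : probability T R) (eps x : R) (F : set (T -> R)) :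
  0 <= x -> (lne (bracketing_number P eps F) <= x%:E)%E ->
  exists2 k, bracket_cover P eps F k & k%:R <= expR (x + 1).
Proof.
move=> x0 h.
(* A strict upper bound on the infimum yields an actual cover. The added 1 is absorbed by
   [exp x + 1 <= exp(x + 1)], valid because [exp x >= 1]. *)
have : (bracketing_number P eps F < (expR x + 1)%:E)%E.
  apply: (@le_lt_trans _ _ (expR x)%:E); last by rewrite lte_fin ltrDl.
  case: (bracketing_number _ _ _) h => [r| |] //=; last first.
    by move=> _; exact: leNye.
  case: (leP r 0) => [r0 _|r0]; rewrite !lee_fin.
    by apply: (le_trans r0); exact: expR_ge0.
  by rewrite -ler_expR lnK.
move=> /ereal_inf_lt[_ [k kc <-]]; rewrite lte_fin => /ltW kx.
exists k => //; apply: (le_trans kx); rewrite expRD.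
have := expR_ge1Dx x; have := @expR_ge1Dx R 1; nra.
Qed.

(** * Risk and least squares criterion through the symmetric difference *)

Lemma symdiff_riskE d (T : measurableType d) (R : realType)
    (P : probability T R) (C C0 : set T) : measurable C -> measurable C0 ->
  symdiff_risk P C C0 = fine (P (C `+` C0)).
Proof.
move=> mC mC0; rewrite /symdiff_risk /Rintegral; congr fine.
rewrite -[in RHS](setIT (C `+` C0)) -integral_indic //; last first.
  by apply: measurableU; exact: measurableD.
apply: eq_integral => x _; congr EFin.
rewrite !indicE in_setU !in_setD.
by case: (x \in C); case: (x \in C0);
  rewrite /= ?subrr ?subr0 ?sub0r ?sqrrN ?expr0n ?expr1n.
Qed.

(** As [fsgn] squares to 1, the terms in [a^2] cancel and each summand of the loss difference is
    [8 a] times [e i] on the symmetric difference, 0 elsewhere. *)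
Lemma le_sq_loss (T : Type) (R : realType) (a : R) (n : nat)
    (x : 'I_n -> T) (e : 'I_n -> R) (C C0 : set T) : 0 < a ->
  let y := fun i => fsgn R C0 (x i) * e i in
  sq_loss a x y C <= sq_loss a x y C0 ->
  \sum_(i < n) e i * \1_(C `+` C0) (x i) <= 0.
Proof.
move=> a0 y; rewrite /sq_loss -subr_le0 -sumrB.
rewrite (eq_bigr (fun i => 8 * a * (e i * \1_(C `+` C0) (x i)))); last first.
  move=> i _; rewrite /y /fsgn !indicE in_setU !in_setD.
  by case: (x i \in C); case: (x i \in C0); rewrite /=; ring.
by rewrite -mulr_sumr pmulr_rle0 // mulr_gt0.
Qed.

(** * Independence of events and expectations of products *)

Lemma prod_indic (T : Type) (R : realType) (I : finType) (B : I -> set T)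
    (w : T) : \prod_i (\1_(B i) w : R) = \1_(\bigcap_i B i) w.
Proof.
rewrite [RHS]indicE; case: (boolP (w \in \bigcap_i B i)) => [|/negP].
  by rewrite inE => h; apply: big1 => i _; rewrite indicE mem_set//; exact: h.
move=> h; have /existsP[i nBi] : [exists i, w \notin B i].
  apply: contrapT => /negP/existsPn nB; apply: h; rewrite inE => i _.
  by have := nB i; rewrite negbK inE.
by rewrite (bigD1 i) //= indicE (negPf nBi) mul0r.
Qed.

(** Distributing the product of sums over all choice functions [f] leaves indicators of
    intersections; independence factors their probabilities, and the same distributive law refolds
    the sum. *)
Lemma integral_prod_step d (Omega : measurableType d) (R : realType)
    (Pr : probability Omega R) (I K : finType) (B : I -> K -> set Omega)
    (c : K -> R) :
  (forall i k, measurable (B i k)) -> (forall k, 0 <= c k) ->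
  (forall f : {ffun I -> K},
     Pr (\bigcap_i B i (f i)) = (\prod_i Pr (B i (f i)))%E) ->
  (\int[Pr]_w (\prod_i \sum_k c k * \1_(B i k) w)%:E =
   (\prod_i \sum_k c k * fine (Pr (B i k)))%:E)%E.
Proof.
move=> mB c0 indep.
have mBf f : measurable (\bigcap_i B i (f i)).
  by apply: fin_bigcap_measurable => // i _; exact: mB.
transitivity (\int[Pr]_w
    (\sum_(f : {ffun I -> K}) (\prod_i c (f i))%:E
       * (\1_(\bigcap_i B i (f i)) w)%:E))%E.
  apply: eq_integral => w _; rewrite bigA_distr_bigA /= -sumEFin.
  by apply: eq_bigr => f _; rewrite big_split /= prod_indic.
rewrite ge0_integral_sum //; last 2 first.
- move=> f; apply/measurable_EFinP; apply: measurable_funM => //.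
- by move=> f w _; rewrite -EFinM lee_fin mulr_ge0 // prodr_ge0.
rewrite bigA_distr_bigA /= -sumEFin; apply: eq_bigr => f _.
rewrite ge0_integralZl //; last 2 first.
- by apply/measurable_EFinP.
- by rewrite lee_fin prodr_ge0.
rewrite integral_indic // setIT [X in (_ * X)%E](indep f).
rewrite big_split /= EFinM; congr (_ * _)%E.
rewrite -prodEFin; apply: eq_bigr => i _.
by rewrite fineK // fin_num_measure.
Qed.

Lemma mutually_independentT d d' (Omega : measurableType d)
    (T : measurableType d') (R : realType) (Pr : probability Omega R) (n : nat)
    (X : 'I_n -> Omega -> T) (S : 'I_n -> set T) :
  mutually_independent Pr X -> (forall i, measurable (S i)) ->
  Pr (\bigcap_i (X i @^-1` S i)) = (\prod_i Pr (X i @^-1` S i))%E.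
Proof.
move=> ind mS; have := ind [set: 'I_n]%SET (fun i => X i @^-1` S i).
under eq_bigl do rewrite finset.inE.
move=> <-; last by move=> i _; exists (S i) => //; rewrite setTI.
by congr (Pr _); apply: eq_bigcapl; split=> i _ //=; rewrite finset.inE.
Qed.

Lemma sigma_rvs_bigcap d d' (Omega : measurableType d) (T : measurableType d')
    (n : nat) (X : 'I_n -> Omega -> T) (S : 'I_n -> set T) :
  (forall i, measurable (S i)) ->
  sigma_rvs X (\bigcap_i (X i @^-1` S i)).
Proof.
move=> mS.
apply: (@fin_bigcap_measurable _
  (g_sigma_algebraType (\bigcup_i sigma_rv (X i)))) => // i _.
by apply: sub_sigma_algebra; exists i => //; exists (S i) => //; rewrite setTI.
Qed.

(** The intersection splits into an event of the [X i] and one of the [Y i]; independence between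
    the two families comes first, then independence within each. *)
Lemma independent_pairs d d' d'' (Omega : measurableType d)
    (T : measurableType d') (U : measurableType d'') (R : realType)
    (Pr : probability Omega R) (n : nat)
    (X : 'I_n -> Omega -> T) (Y : 'I_n -> Omega -> U)
    (S : 'I_n -> set T) (V : 'I_n -> set U) :
  mutually_independent Pr X -> mutually_independent Pr Y ->
  independent_sigma Pr (sigma_rvs X) (sigma_rvs Y) ->
  (forall i, measurable (S i)) -> (forall i, measurable (V i)) ->
  Pr (\bigcap_i (X i @^-1` S i `&` Y i @^-1` V i)) =
  (\prod_i (Pr (X i @^-1` S i) * Pr (Y i @^-1` V i)))%E.
Proof.
move=> iX iY iXY mS mV.
rewrite bigcapI iXY; [|exact: sigma_rvs_bigcap..].
by rewrite !mutually_independentT // big_split.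
Qed.

(** * Exponential weight of a bracket *)

(** [k.1] encodes the sign of the noise, [k.2] membership. Sign 1 selects [Lo] and sign -1 selects
    [U], since these bound [e * \1_D] from below. *)
Definition cell (T : Type) (Lo U : set T) (k : bool * bool) : set T :=
  let E := if k.1 then Lo else U in if k.2 then E else ~` E.

Definition sign_cell (R : realType) (k : bool * bool) : set R :=
  [set if k.1 then 1 else -1].
Arguments sign_cell : clear implicits.

Definition tilt (R : realType) (lam : R) (k : bool * bool) : R :=
  if k.2 then expR (if k.1 then - lam else lam) else 1.

(* For [Lo `<=` D `<=` U] and [e] = 1 or -1, this is [expR (- lam * g)] with [g]
   the lower bracket of [e * \1_D], written as a step function of [(x, e)] so
   that independence of events suffices. It vanishes for any other [e]. *)
Definition weight (T : Type) (R : realType) (lam : R) (Lo U : set T) (x : T)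
    (e : R) : R :=
  \sum_k tilt lam k * (\1_(cell Lo U k) x * \1_(sign_cell R k) e).

Lemma sum_bool2 (R : realType) (F : bool * bool -> R) :
  \sum_k F k = F (true, true) + F (true, false) +
               (F (false, true) + F (false, false)).
Proof.
rewrite (eq_bigr (fun k => (fun s b => F (s, b)) k.1 k.2)); last by case.
by rewrite -(pair_bigA _ (fun s b => F (s, b))) /= !big_bool.
Qed.

Lemma weight_ge0 (T : Type) (R : realType) (lam : R) (Lo U : set T) (x : T)
    (e : R) : 0 <= weight lam Lo U x e.
Proof.
apply: sumr_ge0 => -[s b] _; rewrite mulr_ge0 // /tilt.
by case: ifP => // _; exact: expR_ge0.
Qed.

Lemma weight1 (T : Type) (R : realType) (lam : R) (Lo U : set T) (x : T) :
  weight lam Lo U x 1 = expR (- lam * \1_Lo x).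
Proof.
rewrite /weight sum_bool2 /tilt /cell /sign_cell /= !indicE !in_setC.
have -> : (1 \in [set 1 : R]) by rewrite inE.
have -> : (1 \in [set -1 : R]) = false.
  by apply/negbTE; rewrite notin_setE /=; lra.
by case: (x \in Lo); rewrite /= !(mulr1, mulr0, expR0, addr0, add0r).
Qed.

Lemma weightN1 (T : Type) (R : realType) (lam : R) (Lo U : set T) (x : T) :
  weight lam Lo U x (-1) = expR (lam * \1_U x).
Proof.
rewrite /weight sum_bool2 /tilt /cell /sign_cell /= !indicE !in_setC.
have -> : (-1 \in [set -1 : R]) by rewrite inE.
have -> : (-1 \in [set 1 : R]) = false.
  by apply/negbTE; rewrite notin_setE /=; lra.
by case: (x \in U); rewrite /= !(mulr1, mulr0, expR0, addr0, add0r).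
Qed.

(** Each weight dominates [exp(-lam * e i * \1_D (x i))], and these multiply to the exponential of a
    nonnegative number. *)
Lemma prod_weight_ge1 (T : Type) (R : realType) (lam : R) (Lo D U : set T)
    (n : nat) (x : 'I_n -> T) (e : 'I_n -> R) :
  0 <= lam -> Lo `<=` D -> D `<=` U -> (forall i, e i = 1 \/ e i = -1) ->
  \sum_i e i * \1_D (x i) <= 0 ->
  1 <= \prod_i weight lam Lo U (x i) (e i).
Proof.
move=> lam0 LoD DU e1 sum_le0.
apply: (@le_trans _ _ (\prod_i expR (- lam * (e i * \1_D (x i))))).
  rewrite -expR_sum -mulr_sumr -[leLHS]expR0 ler_expR.
  by rewrite mulNr oppr_ge0 mulr_ge0_le0.
apply: ler_prod => i _; rewrite expR_ge0 /=.
have [->|->] := e1 i; rewrite ?weight1 ?weightN1 ler_expR.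
  rewrite mul1r !mulNr lerN2 ler_wpM2l // !indicE ler_nat.
  by case: (boolP (_ \in Lo)) => //; rewrite inE => /LoD ?; rewrite mem_set.
rewrite mulN1r mulrNN ler_wpM2l // !indicE ler_nat.
by case: (boolP (_ \in D)) => //; rewrite inE => /DU ?; rewrite mem_set.
Qed.

(** * Mean of a weight under the model *)

(** Here [p = P(Lo)] and [q = P(U)]. With tilt [lam], the coefficient of [q] is at most
    [-2 a lam + 2 lam^2]; [lam = a/2] minimizes this, with value [-a^2/2]. *)
Lemma tilted_mean_le (R : realType) (a p q eps : R) :
  0 < a < 1 / 2 -> 0 <= q -> 0 <= eps -> q <= p + eps ->
  (1 / 2 + a) * (expR (- (a / 2)) * p + (1 - p)) +
  (1 / 2 - a) * (expR (a / 2) * q + (1 - q)) <=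
  expR (a * eps - a ^+ 2 / 2 * q).
Proof.
move=> /andP[a0 a2] q0 eps0 qp; apply: le_trans (expR_ge1Dx _).
have em := @expR_le_quadratic R (- (a / 2)) ltac:(lra).
have ep := @expR_le_quadratic R (a / 2) ltac:(lra).
have sm : expR (- (a / 2)) - 1 <= - (a / 2) + a ^+ 2 / 2 by lra.
have sp : expR (a / 2) - 1 <= a / 2 + a ^+ 2 / 2 by lra.
have sm0 : - (a / 2) <= expR (- (a / 2)) - 1.
  by have := @expR_ge1Dx R (- (a / 2)); lra.
move: (expR (- (a / 2))) (expR (a / 2)) sm sp sm0 {em ep} => em ep sm sp sm0.
(* The coefficient of [p] is nonpositive, so [p >= q - eps] bounds its term from above, at a cost of
   at most [(a/2) eps]. *)
have em1 : em - 1 <= 0 by nra.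
have h1 : (em - 1) * p <= (em - 1) * (q - eps) by rewrite ler_wnM2l //; lra.
have h2 : (em - 1) * q <= (- (a / 2) + a ^+ 2 / 2) * q.
  by rewrite ler_wpM2r //; lra.
have h3 : - (a / 2) * eps <= (em - 1) * eps by rewrite ler_wpM2r.
have h4 : (ep - 1) * q <= (a / 2 + a ^+ 2 / 2) * q by rewrite ler_wpM2r //; lra.
have h5 : (em - 1) * p <= (- (a / 2) + a ^+ 2 / 2) * q + a / 2 * eps by nra.
have h6 : (1 / 2 + a) * ((em - 1) * p) <=
          (1 / 2 + a) * ((- (a / 2) + a ^+ 2 / 2) * q + a / 2 * eps).
  by rewrite ler_wpM2l //; lra.
have h7 : (1 / 2 - a) * ((ep - 1) * q) <=
          (1 / 2 - a) * ((a / 2 + a ^+ 2 / 2) * q).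
  by rewrite ler_wpM2l //; lra.
have h8 : 0 <= (1 / 2 - a) * (a * eps) by rewrite !mulr_ge0 //; lra.
have h9 : 0 <= a * eps by rewrite mulr_ge0 //; lra.
nra.
Qed.

Lemma integral_prod_weight d d' (T : measurableType d)
    (Omega : measurableType d') (R : realType) (P : probability T R)
    (Pr : probability Omega R) (n : nat) (X : 'I_n -> {RV Pr >-> T})
    (eta : 'I_n -> {RV Pr >-> R}) (a eps : R) (Lo U : set T) :
  0 < a < 1 / 2 ->
  (forall i A, measurable A -> distribution Pr (X i) A = P A) ->
  mutually_independent Pr (fun i => X i : Omega -> T) ->
  (forall i, Pr (eta i @^-1` [set 1]) = (1 / 2 + a)%:E /\
             Pr (eta i @^-1` [set -1]) = (1 / 2 - a)%:E) ->
  mutually_independent Pr (fun i => eta i : Omega -> R) ->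
  independent_sigma Pr (sigma_rvs (fun i => X i : Omega -> T))
                       (sigma_rvs (fun i => eta i : Omega -> R)) ->
  measurable Lo -> measurable U -> 0 <= eps ->
  (P U <= P Lo + eps%:E)%E ->
  (\int[Pr]_w (\prod_i weight (a / 2) Lo U (X i w) (eta i w))%:E <=
   (expR ((a * eps - a ^+ 2 / 2 * fine (P U)) *+ n))%:E)%E.
Proof.
move=> a01 PX iX Peta ieta iXeta mLo mU eps0 PU.
have mcell k : measurable (cell Lo U k).
  by rewrite /cell; case: k => -[] [] //=; exact: measurableC.
have msign k : measurable (sign_cell R k) by exact: measurable_set1.
have pcell i k : Pr (X i @^-1` cell Lo U k) = P (cell Lo U k).
  by rewrite -(PX i).
pose B i k := X i @^-1` cell Lo U k `&` eta i @^-1` sign_cell R k.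
have mX i k : measurable (X i @^-1` cell Lo U k).
  by rewrite -[X in measurable X]setTI; exact: measurable_funPT.
have meta i k : measurable (eta i @^-1` sign_cell R k).
  by rewrite -[X in measurable X]setTI; exact: measurable_funPT.
have mB i k : measurable (B i k) by exact: measurableI.
have PB i k : Pr (B i k) = (P (cell Lo U k) * Pr (eta i @^-1` sign_cell R k))%E.
  rewrite -(pcell i); apply: iXeta.
    apply: sub_sigma_algebra; exists i => //.
    by exists (cell Lo U k) => //; rewrite setTI.
  apply: sub_sigma_algebra; exists i => //.
  by exists (sign_cell R k) => //; rewrite setTI.
have -> : (\int[Pr]_w (\prod_i weight (a / 2) Lo U (X i w) (eta i w))%:E =
    \int[Pr]_w (\prod_i \sum_k tilt (a / 2) k * \1_(B i k) w)%:E)%E.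
  apply: eq_integral => w _; congr EFin; apply: eq_bigr => i _.
  by apply: eq_bigr => k _; rewrite /B indicI.
rewrite (integral_prod_step (B := B)) //; last 2 first.
- by case=> s b; rewrite /tilt; case: ifP => // _; exact: expR_ge0.
- move=> f; rewrite (independent_pairs iX ieta iXeta) //.
  by apply: eq_bigr => i _; rewrite PB pcell.
have fin S : measurable S -> P S \is a fin_num.
  exact: fin_num_measure.
have tilt_ge0 k : 0 <= tilt (a / 2) k.
  by rewrite /tilt; case: ifP => // _; exact: expR_ge0.
(* The bound becomes a product over ['I_n], compared factor by factor with the one-observation
   means. *)
rewrite lee_fin -[X in expR (_ *+ X)]card_ord -sumr_const expR_sum.
apply: ler_prod => i _; apply/andP; split.
  by apply: sumr_ge0 => k _; rewrite mulr_ge0 // fine_ge0.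
have [Peta1 PetaN1] := Peta i.
rewrite sum_bool2 !PB /sign_cell /tilt /cell /= Peta1 PetaN1.
rewrite !fineM ?fin //=; try exact: measurableC.
rewrite !probability_setC // !fineB ?fin //=.
have PUr : fine (P U) <= fine (P Lo) + eps.
  by rewrite -lee_fin EFinD !fineK ?fin.
have := @tilted_mean_le R a (fine (P Lo)) (fine (P U)) eps a01 _ eps0 PUr.
rewrite fine_ge0 // => /(_ isT); apply: le_trans.
rewrite le_eqVlt; apply/orP; left; apply/eqP; ring.
Qed.

Lemma measurable_weight d d' (T : measurableType d) (Omega : measurableType d')
    (R : realType) (Pr : probability Omega R) (X : {RV Pr >-> T})
    (eta : {RV Pr >-> R}) (lam : R) (Lo U : set T) :
  measurable Lo -> measurable U ->
  measurable_fun setT (fun w => weight lam Lo U (X w) (eta w)).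
Proof.
move=> mLo mU; apply: measurable_sum => k; apply: measurable_funM => //.
have mcell : measurable (cell Lo U k).
  by rewrite /cell; case: k => -[] [] //=; exact: measurableC.
apply: measurable_funM.
  have mc := @measurable_indic _ _ R setT _ mcell.
  exact: (measurableT_comp mc (measurable_funPT X)).
have ms := @measurable_indic _ _ R setT (sign_cell R k) (measurable_set1 _).
exact: (measurableT_comp ms (measurable_funPT eta)).
Qed.

(** The two probabilities add up to 1, so no mass remains for other values. *)
Lemma ae_sign d (Omega : measurableType d) (R : realType)
    (Pr : probability Omega R) (eta : {RV Pr >-> R}) (a : R) :
  Pr (eta @^-1` [set 1]) = (1 / 2 + a)%:E ->
  Pr (eta @^-1` [set -1]) = (1 / 2 - a)%:E ->
  \forall w \ae Pr, eta w = 1 \/ eta w = -1.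
Proof.
move=> P1 PN1.
have m1 (r : R) : measurable (eta @^-1` [set r]).
  by rewrite -[X in measurable X]setTI; exact: measurable_funPT.
exists (~` (eta @^-1` [set 1] `|` eta @^-1` [set -1])); split => //.
  by apply: measurableC; exact: measurableU.
rewrite probability_setC; last exact: measurableU.
rewrite measureU //; last first.
  by rewrite -subset0 => w /= [->]; lra.
rewrite [X in (_ - (X + _)%R)%E]P1 [X in (_ - (_ + X)%R)%E]PN1.
rewrite -[(_ + _)%R]EFinD (_ : 1 / 2 + a + (1 / 2 - a) = 1); last by lra.
by rewrite subrr.
Qed.

(** * From a finite family of brackets to the risk *)

Lemma risk_le_brackets d d' (T : measurableType d)
    (Omega : measurableType d') (R : realType) (P : probability T R)
    (Pr : probability Omega R) (n : nat) (X : 'I_n -> {RV Pr >-> T})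
    (eta : 'I_n -> {RV Pr >-> R}) (a eps y : R) (C0 : set T)
    (Chat : Omega -> set T) (k : nat) (A B : 'I_k -> set T) :
  0 < a < 1 / 2 ->
  (forall i E, measurable E -> distribution Pr (X i) E = P E) ->
  mutually_independent Pr (fun i => X i : Omega -> T) ->
  (forall i, Pr (eta i @^-1` [set 1]) = (1 / 2 + a)%:E /\
             Pr (eta i @^-1` [set -1]) = (1 / 2 - a)%:E) ->
  mutually_independent Pr (fun i => eta i : Omega -> R) ->
  independent_sigma Pr (sigma_rvs (fun i => X i : Omega -> T))
                       (sigma_rvs (fun i => eta i : Omega -> R)) ->
  0 <= eps -> 0 <= y -> k%:R <= expR y ->
  (forall j, [/\ measurable (A j), measurable (B j)
               & (P (B j `\` A j) <= eps%:E)%E]) ->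
  (forall w, exists j, A j `<=` Chat w /\ Chat w `<=` B j) ->
  measurable C0 -> (forall w, measurable (Chat w)) ->
  (forall w, \sum_i eta i w * \1_(Chat w `+` C0) (X i w) <= 0) ->
  measurable_fun setT (fun w => symdiff_risk P (Chat w) C0) ->
  ((a ^+ 2 / 2 * n%:R)%:E * 'E_Pr[fun w => symdiff_risk P (Chat w) C0] <=
   (y + a * eps * n%:R + 1)%:E)%E.
Proof.
move=> a01 PX iX Peta ieta iXeta eps0 y0 ky AB cov mC0 mC sum_le0 mrisk.
have /andP[a0 a2] := a01.
(* If [A j] and [B j] bracket [C], then [Lo j] and [U j] bracket its symmetric difference with
   [C0]. *)
pose Lo j := (A j `\` C0) `|` (C0 `\` B j).
pose U j := (B j `\` C0) `|` (C0 `\` A j).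
have mLo j : measurable (Lo j).
  by have [? ? _] := AB j; apply: measurableU; exact: measurableD.
have mU j : measurable (U j).
  by have [? ? _] := AB j; apply: measurableU; exact: measurableD.
have PU j : (P (U j) <= P (Lo j) + eps%:E)%E.
  have [mA mB le_eps] := AB j.
  have mBA : measurable (B j `\` A j) by exact: measurableD.
  apply: (@le_trans _ _ (P (Lo j `|` (B j `\` A j)))); last first.
    by apply: (le_trans (measureU2 _ _ _)) => //; exact: leeD2l.
  apply: le_measure; rewrite ?inE//; first exact: measurableU.
  move=> x; rewrite /U /Lo /=.
  by have [|] := pselect (A j x); have [|] := pselect (B j x); tauto.
pose W j w := \prod_i weight (a / 2) (Lo j) (U j) (X i w) (eta i w).
have W0 j w : 0 <= W j w by apply: prodr_ge0 => i _; exact: weight_ge0.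
(* Minus the exponent in the bound on the mean of [W j]. *)
pose s j := (a ^+ 2 / 2 * fine (P (U j)) - a * eps) *+ n.
have EW j : (\int[Pr]_w (W j w)%:E <= (expR (- s j))%:E)%E.
  rewrite /s -mulNrn opprB.
  exact: (integral_prod_weight a01 PX iX Peta ieta iXeta).
pose c0 := y + a * eps * n%:R.
have c00 : 0 <= c0 by rewrite addr_ge0 // !mulr_ge0 // ltW.
have b0 : 0 <= a ^+ 2 / 2 * n%:R by rewrite !mulr_ge0 // ltW.
have risk0 C : 0 <= symdiff_risk P C C0.
  by apply: Rintegral_ge0 => x _; exact: sqr_ge0.
have mW j : measurable_fun setT (W j).
  by apply: measurable_prod => i _; exact: measurable_weight.
rewrite unlock -ge0_integralZl //; last 2 first.
- exact/measurable_EFinP.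
- by move=> w _; rewrite lee_fin.
(* The bracket of [Chat w] depends on [w]; summing over all [j] gives a majorant free of this
   choice. *)
apply: (@le_trans _ _
   (\int[Pr]_w (c0%:E + \sum_j (expR (s j - y))%:E * (W j w)%:E))%E).
  apply: ae_ge0_le_integral => //.
  - by move=> w _; rewrite -EFinM lee_fin mulr_ge0.
  - by apply: measurable_funeM; exact/measurable_EFinP.
  - move=> w _; rewrite adde_ge0 // sume_ge0 // => j _.
    by rewrite -EFinM lee_fin mulr_ge0 // expR_ge0.
  - apply: emeasurable_funD => //; apply: emeasurable_sum => j.
    by apply: measurable_funeM; exact/measurable_EFinP.
  have : \forall w \ae Pr, forall i, eta i w = 1 \/ eta i w = -1.
    apply: filter_forall => i; have [P1 PN1] := Peta i.
    exact: ae_sign P1 PN1.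
  apply: filterS => w sgn _.
  have [j [AC CB]] := cov w.
  have W1 : 1 <= W j w.
    apply: (@prod_weight_ge1 _ _ _ _ (Chat w `+` C0)) => //.
    - by rewrite divr_ge0 // ltW.
    - by rewrite /Lo => x [[/AC ? ?]|[? nB]]; [left|right; split=> // /CB].
    - by rewrite /U => x [[/CB ? ?]|[? nC]]; [left|right; split=> // /AC].
  under eq_bigr do rewrite -EFinM.
  rewrite sumEFin -EFinM -EFinD lee_fin symdiff_riskE //.
  have q_le : fine (P (Chat w `+` C0)) <= fine (P (U j)).
    have mD : measurable (Chat w `+` C0).
      by apply: measurableU; exact: measurableD.
    apply: fine_le; rewrite ?fin_num_measure//.
    apply: le_measure; rewrite ?inE//.
    by rewrite /U => x [[/CB ? ?]|[? nC]]; [left|right; split=> // /AC].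
  (* By the definitions of [c0] and [s], the right side equals [(a^2/2) n P(U j)]. *)
  apply: (@le_trans _ _ (c0 + (s j - y))).
    rewrite /c0 /s -[in X in _ <= X]mulr_natl.
    have := ler_wpM2l b0 q_le; lra.
  rewrite lerD2l (bigD1 j) //= -[leLHS]addr0 lerD //; last first.
    by apply: sumr_ge0 => i _; rewrite mulr_ge0 // expR_ge0.
  apply: (@le_trans _ _ (expR (s j - y))).
    by have := expR_ge1Dx (s j - y); lra.
  by rewrite ler_peMr // expR_ge0.
rewrite ge0_integralD //; last 2 first.
- move=> w _; rewrite sume_ge0 // => j _.
  by rewrite -EFinM lee_fin mulr_ge0 // expR_ge0.
- apply: emeasurable_sum => j.
  by apply: measurable_funeM; exact/measurable_EFinP.
rewrite integral_cst // [X in (_ * X + _)%E]probability_setT mule1 [leRHS]EFinD.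
apply: leeD2l.
rewrite ge0_integral_sum //; last 2 first.
- by move=> j; apply: measurable_funeM; exact/measurable_EFinP.
- by move=> j w _; rewrite -EFinM lee_fin mulr_ge0 // expR_ge0.
(* The factors [exp(s j)] and [exp(- s j)] cancel; the [k <= exp y] remaining terms [exp(- y)] sum
   to at most 1. *)
apply: (@le_trans _ _ (\sum_(j < k) (expR (- y))%:E)%E).
  apply: lee_sum => j _; rewrite ge0_integralZl //; last 2 first.
  - exact/measurable_EFinP.
  - by move=> w _; rewrite lee_fin.
  apply: (le_trans (lee_wpmul2l _ (EW j))); first by rewrite lee_fin expR_ge0.
  by rewrite -EFinM lee_fin -expRD addrAC subrr add0r.
rewrite sumEFin lee_fin sumr_const card_ord -mulr_natl expRN.
by rewrite ler_pdivrMr ?mul1r // expR_gt0.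
Qed.

(** * Choice of the scale and the rate *)

Theorem theorem3p4 (R : realType) (alpha L a : R)
    (halpha0 : 0 < alpha) (halpha1 : alpha != 1) (hL : 0 < L)
    (ha : 0 < a < 1 / 2) :
  exists K : R, 0 < K /\
  forall (d : measure_display) (T : measurableType d) (P : probability T R)
    (CC : set (set T)),
    countable CC ->
    (forall C, CC C -> measurable C) ->
    (forall eps : R, 0 < eps ->
       (lne (bracketing_number P eps (indicators R CC))
        <= (L * eps `^ (- alpha))%:E)%E) ->
  forall (n : nat), (0 < n)%N ->
  forall (d' : measure_display) (Omega : measurableType d')
    (Pr : probability Omega R)
    (X : 'I_n -> {RV Pr >-> T}) (eta : 'I_n -> {RV Pr >-> R}),
    (forall i A, measurable A -> distribution Pr (X i) A = P A) ->
    mutually_independent Pr (fun i => X i : Omega -> T) ->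
    (forall i, Pr (eta i @^-1` [set 1]) = (1 / 2 + a)%:E /\
               Pr (eta i @^-1` [set -1]) = (1 / 2 - a)%:E) ->
    mutually_independent Pr (fun i => eta i : Omega -> R) ->
    independent_sigma Pr (sigma_rvs (fun i => X i : Omega -> T))
                         (sigma_rvs (fun i => eta i : Omega -> R)) ->
  let xs : Omega -> 'I_n -> T := fun w i => X i w in
  let ys : set T -> Omega -> 'I_n -> R :=
    fun C0 w i => fsgn R C0 (X i w) * eta i w in
  forall (Chat : ('I_n -> T) -> ('I_n -> R) -> set T),
    (forall C0, CC C0 -> forall w,
       argmin CC (sq_loss a (xs w) (ys C0 w)) (Chat (xs w) (ys C0 w))) ->
    (forall C0, CC C0 ->
       measurable_fun setT
         (fun w => symdiff_risk P (Chat (xs w) (ys C0 w)) C0)) ->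
  (ereal_sup
     [set 'E_Pr[fun w => symdiff_risk P (Chat (xs w) (ys C0 w)) C0]
     | C0 in CC]
   <= (K * n%:R `^ (- (1 / (alpha + 1))))%:E)%E.
Proof.
have /andP[a0 a2] := ha.
(* With [y = L m delta + 1] and [eps = delta], the bracket bound is [(L + a) m delta + 2], hence at
   most [(L + a + 2) m delta] because [m delta >= 1]; then divide by [(a^2/2) m]. *)
exists ((L + a + 2) * (a ^+ 2 / 2)^-1); split.
  by rewrite mulr_gt0 ?invr_gt0 ?divr_gt0 ?exprn_gt0 //; lra.
move=> d T P CC _ mCC entropy n n0 d' Omega Pr X eta PX iX Peta ieta iXeta.
move=> xs ys Chat Chat_min mrisk.
pose m : R := n%:R.
have m1 : 1 <= m by rewrite ler1n.
have m0 : 0 < m by rewrite ltr0n.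
pose delta := m `^ (- (1 / (alpha + 1))).
have delta0 : 0 < delta by exact: powR_gt0.
have alpha1 : alpha + 1 != 0 by rewrite gt_eqF // addr_gt0.
(* Balance of entropy and bracket size: [alpha/(alpha+1) = 1 - 1/(alpha+1)]. *)
have powE : delta `^ (- alpha) = m * delta.
  transitivity (m `^ 1 * delta); last by rewrite powRr1 // ltW.
  rewrite /delta -powRrM -powRD; last by rewrite (gt_eqF m0) implybT.
  by congr (_ `^ _); field.
have mdelta1 : 1 <= m * delta.
  rewrite -powE /delta -powRrM -[leLHS](@powRr0 R m) ler_powR //.
  by rewrite mulrNN mulr_ge0 ?divr_ge0 // ?ltW // addr_gt0.
apply: ge_ereal_sup => _ [C0 CC0 <-].
pose x := L * delta `^ (- alpha).
have x0 : 0 <= x by rewrite mulr_ge0 ?powR_ge0 // ltW.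
have [k [A [B [AB cov]]] kx] : exists2 k,
    exists A B : 'I_k -> set T,
      (forall j, [/\ measurable (A j), measurable (B j)
                   & (P (B j `\` A j) <= delta%:E)%E]) /\
      (forall C, CC C -> exists j, A j `<=` C /\ C `<=` B j)
    & k%:R <= expR (x + 1).
  have [k kcov kx] := bracketing_number_lne x0 (entropy _ delta0).
  by exists k => //; exact: bracket_cover_sets.
have CChat w : CC (Chat (xs w) (ys C0 w)) by have [] := Chat_min _ CC0 w.
have y0 : 0 <= x + 1 by rewrite addr_ge0.
have := risk_le_brackets ha PX iX Peta ieta iXeta (ltW delta0) y0 kx AB
  (fun w => cov _ (CChat w)) (mCC _ CC0) (fun w => mCC _ (CChat w)) _
  (mrisk _ CC0).
have basic w :
    \sum_i eta i w * \1_(Chat (xs w) (ys C0 w) `+` C0) (X i w) <= 0.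
  by apply: (le_sq_loss a0); have [_] := Chat_min _ CC0 w; exact.
have b0 : 0 < a ^+ 2 / 2 * m by rewrite !mulr_gt0 ?invr_gt0.
move=> /(_ basic); rewrite -lee_pdivlMl // => /le_trans; apply.
rewrite -EFinM lee_fin /x powE -/m -/delta.
have mK : a ^+ 2 / 2 * m * ((L + a + 2) * (a ^+ 2 / 2)^-1 * delta) =
    (L + a + 2) * (m * delta).
  by field; rewrite gt_eqF.
rewrite ler_pdivrMl // mK; nra.
Qed.
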